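(* Let $n\in\mathbb{N}\setminus\{1,2\}$ and let $\Lambda_n(t,W)\in\mathcal{M}(\mathcal{O}_n)$ be a cyclotomic model set. Further, let $u\in\mathbb{S}^1$ be a non-$\mathcal{O}_n$-direction. Then, $\mathcal{F}(\Lambda_n(t,W))$ is determined by the single $X$-ray in direction $u$.
   Context: Identify $\mathbb{C}$ with $\mathbb{R}^2$. Let $\zeta_n=e^{2\pi i/n}$, $\mathbb{K}_n=\mathbb{Q}(\zeta_n)$, $\mathcal{O}_n=\mathbb{Z}[\zeta_n]$, and let $\phi$ be Euler's totient function. Cyclotomic model sets. For $n\in\mathbb{N}\setminus\{1,2\}$, choose exactly one automorphism from each pair of complex conjugate automorphisms in $\mathrm{Gal}(\mathbb{K}_n/\mathbb{Q})$, obtaining $\sigma_1=\mathrm{id},\sigma_2,\dots,\sigma_{\phi(n)/2}$. The associated star map $\star:\mathcal{O}_n\to(\mathbb{R}^2)^{\phi(n)/2-1}$ is $z\mapsto(\sigma_2(z),\dots,\sigma_{\phi(n)/2}(z))$; if $n\in\{3,4,6\}$, $(\mathbb{R}^2)^{0}$ is the trivial group $\{0\}$ and the star map is $0$. A window is a set $W\subset(\mathbb{R}^2)^{\phi(n)/2-1}$ with $\varnothing\neq W^\circ\subset W\subset\overline{W^\circ}$ and $\overline{W^\circ}$ compact. For a window $W$ and $t\in\mathbb{R}^2$ set $\Lambda_n(t,W)=t+\{z\in\mathcal{O}_n : z^\star\in W\}$. $\mathcal{M}(\mathcal{O}_n)$ is the collection of all sets $\Lambda_n(t,W)$ (all $t$,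 all windows $W$, all choices of star map); its elements are called cyclotomic model sets. $\mathcal{F}(S)$ denotes the set of all finite subsets of $S\subset\mathbb{R}^2$. A direction is an element of $\mathbb{S}^1$; an $\mathcal{O}_n$-direction is a direction parallel to a non-zero element of $\mathcal{O}_n$; a non-$\mathcal{O}_n$-direction is a direction that is not an $\mathcal{O}_n$-direction. For a finite $F\subset\mathbb{R}^2$ and a direction $u$, the $X$-ray $X_uF$ is the function assigning to each line $\ell$ parallel to $u$ the number $\operatorname{card}(F\cap\ell)$. A collection $\mathcal{E}$ of finite subsets of $\mathbb{R}^2$ is determined by the $X$-rays in the directions of a finite set $U$ of directions if for all $F,F'\in\mathcal{E}$: $(X_uF=X_uF'\ \forall u\in U)\Rightarrow F=F'$. *)

(* Defs.v *)
From HB Require Import structures.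
From mathcomp Require Import all_boot all_order all_algebra finmap.
From mathcomp Require Import all_classical all_reals all_analysis.
From mathcomp Require Export complex.

Set Implicit Arguments.
Unset Strict Implicit.
Unset Printing Implicit Defensive.

Import Order.TTheory GRing.Theory Num.Theory.
Import numFieldNormedType.Exports.

Local Open Scope classical_set_scope.
Local Open Scope ring_scope.

(* The Euclidean plane, identified with the complex numbers.  The ascribed type
   makes the norm topology of a numClosedFieldType available; its balls are the
   open Euclidean discs, since 0 < e in R[i] forces e to be real. *)
Definition Cplx (R : realType) : numClosedFieldType := R[i].

Definition toC (R : realType) (x : R) : Cplx R := (x%:C)%C.

Definition zeta (R : realType) (n : nat) : Cplx R :=
  (cos (2 * pi / n%:R) +i* sin (2 * pi / n%:R))%C.

(* Q(zeta_n) is the smallest subfield of the complex numbers that contains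
   zeta_n; a subfield contains Q automatically. *)
Definition Kn_pred (R : realType) (n : nat) : {pred Cplx R} :=
  [pred z | `[< forall S : {pred Cplx R},
                  divring_closed S -> zeta R n \in S -> z \in S >]].

Arguments Kn_pred R n : clear implicits.

Lemma Kn_predP (R : realType) (n : nat) (z : Cplx R) :
  reflect (forall S : {pred Cplx R},
             divring_closed S -> zeta R n \in S -> z \in S)
          (z \in Kn_pred R n).
Proof. exact: asboolP. Qed.

Lemma Kn_divring_closed (R : realType) (n : nat) :
  divring_closed (Kn_pred R n).
Proof.
split=> [|x y /Kn_predP xK /Kn_predP yK|x y /Kn_predP xK /Kn_predP yK];
  apply/Kn_predP => S SD Sz; have [S1 SB SV] := SD => //.
- by apply: SB; [exact: (xK S SD Sz) | exact: (yK S SD Sz)].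
- by apply: SV; [exact: (xK S SD Sz) | exact: (yK S SD Sz)].
Qed.

HB.instance Definition _ (R : realType) (n : nat) :=
  GRing.isDivringClosed.Build (Cplx R) (Kn_pred R n)
    (Kn_divring_closed R n).

Record Kn (R : realType) (n : nat) :=
  MkKn { Kn_val :> Cplx R; Kn_valP : Kn_val \in Kn_pred R n }.

HB.instance Definition _ (R : realType) (n : nat) :=
  [isSub for @Kn_val R n].
HB.instance Definition _ (R : realType) (n : nat) :=
  [Choice of Kn R n by <:].
HB.instance Definition _ (R : realType) (n : nat) :=
  [SubChoice_isSubIntegralDomain of Kn R n by <:].
HB.instance Definition _ (R : realType) (n : nat) :=
  [SubIntegralDomain_isSubField of Kn R n by <:].

Definition On (R : realType) (n : nat) : set (Cplx R) :=
  [set (map_poly intr p).[zeta R n] | p in [set: {poly int}]].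

(* An element of Gal(K_n/Q) is a bijective ring endomorphism of K_n: such a map
   fixes Q automatically. *)
Definition is_Gal (R : realType) (n : nat)
    (s : {rmorphism Kn R n -> Kn R n}) : Prop := bijective s.

(* phi(n)/2 - 1; for n >= 3, phi(n) is even and positive, so that
   (n_star n).+1 = phi(n)/2. *)
Definition n_star (n : nat) : nat := (totient n)./2.-1.

(* sigma_1, ..., sigma_(phi(n)/2), indexed from 0: sigma_1 is the identity, and
   each pair {tau, conj o tau} contains exactly one sigma_i. *)
Definition star_choice (R : realType) (n : nat)
    (s : 'I_(n_star n).+1 -> {rmorphism Kn R n -> Kn R n}) : Prop :=
  [/\ forall i, is_Gal (s i),
      forall z, s ord0 z = z &
      forall tau : {rmorphism Kn R n -> Kn R n}, is_Gal tau ->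
        exists! i, (forall z, s i z = tau z) \/
                   (forall z, Kn_val (s i z) = (Kn_val (tau z))^*)].

(* The star map, defined on all of K_n; only its values on O_n are used. *)
Definition star (R : realType) (n : nat)
    (s : 'I_(n_star n).+1 -> {rmorphism Kn R n -> Kn R n})
    (z : Kn R n) : 'rV[Cplx R]_(n_star n) :=
  \row_i Kn_val (s (lift ord0 i) z).

Definition window (R : realType) (m : nat) (W : set 'rV[Cplx R]_m) : Prop :=
  [/\ W° !=set0, W `<=` closure W° & compact (closure W°)].

Definition model_set (R : realType) (n : nat)
    (s : 'I_(n_star n).+1 -> {rmorphism Kn R n -> Kn R n})
    (t : Cplx R) (W : set 'rV[Cplx R]_(n_star n)) : set (Cplx R) :=
  [set t + Kn_val z | z in [set z : Kn R n | On n (Kn_val z) /\ W (star s z)]].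

Definition cyclotomic_model_sets (R : realType) (n : nat) :
    set (set (Cplx R)) :=
  [set L | exists s t W,
     [/\ @star_choice R n s, window W & L = model_set s t W]].

Definition finite_subsets (R : realType) (S : set (Cplx R)) :
    set {fset Cplx R} :=
  [set F : {fset Cplx R} | [set` F] `<=` S].

Definition direction (R : realType) (u : Cplx R) : Prop := `|u| = 1.

Definition parallel (R : realType) (u v : Cplx R) : Prop :=
  exists2 r : R, r != 0 & u = toC r * v.

Definition On_direction (R : realType) (n : nat) (u : Cplx R) : Prop :=
  direction u /\ exists z, [/\ On n z, z != 0 & parallel u z].

Definition non_On_direction (R : realType) (n : nat) (u : Cplx R) : Prop :=
  direction u /\ ~ On_direction n u.

Definition line_through (R : realType) (u p : Cplx R) : set (Cplx R) :=
  [set p + toC r * u | r in [set: R]].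

Definition lines (R : realType) (u : Cplx R) : set (set (Cplx R)) :=
  range (line_through u).

Definition Xray (R : realType) (u : Cplx R) (F : {fset Cplx R})
    (l : {l : set (Cplx R) | lines u l}) : nat :=
  #|` [fset z in F | z \in sval l]%fset|.

(* U is meant to be a finite set of directions. *)
Definition determined_by_Xrays (R : realType) (E : set {fset Cplx R})
    (U : {fset Cplx R}) : Prop :=
  forall F F' : {fset Cplx R}, E F -> E F' ->
    (forall u, u \in U -> @Xray R u F = @Xray R u F') -> F = F'.

(* Main.v *)
Require Import Defs.
From mathcomp Require Import all_boot all_order all_algebra finmap.
From mathcomp Require Import all_classical all_reals all_analysis.

(** A line in a non-[O_n]-direction [u] meets a cyclotomic model set in at most
    one point: two points of the model set differ by an element of the additive
    group [O_n], and a nonzero difference along [u] would make [u] an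
    [O_n]-direction ([line_meets_model_set_once]).  Hence the X-ray of a finite
    subset [F] in direction [u] takes only the values 0 and 1, and a line on
    which it is 1 singles out the point of [F] that it carries, as the only
    point of the model set on that line ([determined_by_single_Xray]). *)

Import GRing.Theory Num.Theory.

Local Open Scope ring_scope.

Lemma On_sub (R : realType) (n : nat) (x y : Cplx R) :
  On n x -> On n y -> On n (x - y).
Proof.
move=> [p _ <-] [q _ <-]; exists (p - q) => //.
by rewrite rmorphB hornerD hornerN.
Qed.

Lemma model_set_sub (R : realType) (n : nat) (L : set (Cplx R)) (x y : Cplx R) :
  cyclotomic_model_sets n L -> L x -> L y -> On n (x - y).
Proof.
move=> [s [t [W [_ _ ->]]]] [a [Oa _] <-] [b [Ob _] <-].
by rewrite opprD addrACA subrr add0r; exact: On_sub.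
Qed.

Lemma line_meets_model_set_once (R : realType) (n : nat) (L : set (Cplx R))
    (u x y : Cplx R) :
  cyclotomic_model_sets n L -> non_On_direction n u ->
  L x -> L y -> line_through u x y -> y = x.
Proof.
move=> hL [du nu] Lx Ly [r _ yE].
have [r0|r0] := eqVneq r 0; first by rewrite -yE r0 mul0r addr0.
have dE : y - x = toC r * u by rewrite -yE addrC addKr.
have rC0 : toC r != 0 by rewrite fmorph_eq0.
have u0 : u != 0 by rewrite -normr_eq0 du oner_eq0.
case: nu; split=> //; exists (y - x); split.
- exact: model_set_sub hL Ly Lx.
- by rewrite dE mulf_neq0.
- exists r^-1; first by rewrite invr_eq0.
  by rewrite dE /toC fmorphV mulKf.
Qed.

(** The X-ray along the line through a point [x] of [F] is positive, so the
    other set also has a point on that line; it must be [x] again. *)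
Lemma sub_of_eq_Xray (R : realType) (S : set (Cplx R)) (u : Cplx R)
    (F F' : {fset Cplx R}) :
  (forall x y, S x -> S y -> line_through u x y -> y = x) ->
  finite_subsets S F -> finite_subsets S F' ->
  @Xray R u F = @Xray R u F' -> (F `<=` F')%fset.
Proof.
move=> once SF SF' eqX; apply/fsubsetP => x xF.
have lx : lines u (line_through u x) by exists x.
have xx : line_through u x x by exists 0 => //; rewrite mul0r addr0.
have : (0 < Xray F' (exist _ _ lx))%N.
  rewrite -eqX cardfs_gt0; apply/fset0Pn; exists x.
  by rewrite !inE xF /=; apply/asboolP.
rewrite cardfs_gt0 => /fset0Pn[y]; rewrite !inE => /andP[yF' /asboolP xy].
by rewrite -(once x y (SF _ xF) (SF' _ yF') xy).
Qed.

Lemma determined_by_single_Xray (R : realType) (S : set (Cplx R)) (u : Cplx R) :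
  (forall x y, S x -> S y -> line_through u x y -> y = x) ->
  determined_by_Xrays (finite_subsets S) [fset u]%fset.
Proof.
move=> once F F' SF SF' eqX.
have eqXu : @Xray R u F = @Xray R u F' by apply: eqX; rewrite inE.
by apply/eqP; rewrite eqEfsubset !(@sub_of_eq_Xray R S u).
Qed.

Theorem proposition7 (R : realType) (n : nat) (hn : (2 < n)%N)
    (L : set (Cplx R)) (hL : cyclotomic_model_sets n L)
    (u : Cplx R) (hu : non_On_direction n u) :
  determined_by_Xrays (finite_subsets L) [fset u]%fset.
Proof.
apply: determined_by_single_Xray => x y.
exact: line_meets_model_set_once hL hu.
Qed.
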